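(* Let $F$ be a field of characteristic not two and let $E$ be a finite-dimensional vector space over $F$ with an arbitrary symmetric bilinear form $(U,V)\mapsto U\cdot V$. Let $\overline{uvw}$ be a non-null projective triangle in $E$ with projective quadrance $q_w=q(u,v)$ and projective spreads $S_u=S(uv,uw)$, $S_v=S(vw,vu)$, $S_w=S(wu,wv)$ (all three assumed to be defined). If $q_w=1$, then $$S_w=S_u+S_v-S_uS_v.$$
   Context: A projective point $u=[U]$ is a one-dimensional subspace of $E$, spanned by a non-zero vector $U$; it is null if $U\cdot U=0$, and non-null otherwise. For distinct projective points $u,v$, $uv$ denotes the projective line (two-dimensional subspace) they span. A projective triangle $\overline{uvw}$ is a set of three distinct projective points not contained in a common two-dimensional subspace; it is null if at least one of its projective points is null, and non-null otherwise. The projective quadrance between non-null projective points $u=[U]$, $v=[V]$ is $$q(u,v)=1-\frac{(U\cdot V)^2}{(U\cdot U)(V\cdot V)}.$$ The projective spread between the projective lines $wu$ and $wv$, where $u=[U]$, $v=[V]$, $w=[W]$ with $w$ non-null, is, putting $U'=U-\frac{U\cdot W}{W\cdot W}W$ and $V'=V-\frac{V\cdot W}{W\cdot W}W$, $$S(wu,wv)=1-\frac{(U'\cdot V')^2}{(U'\cdot U')(V'\cdot V')},$$ and it is undefined if one of the denominators is zero. Equivalently, with $a_X=X\cdot X$ and $b_{XY}=X\cdot Y$, $$S(wu,wv)=1-\frac{(a_Wb_{UV}-b_{UW}b_{VW})^2}{(a_Ua_W-b_{UW}^2)(a_Va_W-b_{VW}^2)}.$$ The bilinear form is not assumed non-degenerate.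 *)

(* Defs.v *)
From HB Require Import structures.
From mathcomp Require Import all_boot all_order all_algebra.
From mathcomp Require Import ring.
Set Implicit Arguments.
Unset Strict Implicit.
Unset Printing Implicit Defensive.
Import GRing.Theory.
Local Open Scope ring_scope.

Section Points.
Variables (F : fieldType) (E : vectType F).

Record ppoint := PPoint {
  pspace :> {vspace E};
  ppointP : \dim pspace == 1%N }.

HB.instance Definition _ := [isSub for pspace].
HB.instance Definition _ := [Equality of ppoint by <:].

(* A spanning vector of u; the notions below do not depend on this choice, *)
(* see pnullE, quadranceE, spread_definedE and spreadE.                    *)
Definition prep (u : ppoint) : E := vpick u.

Lemma prep_neq0 u : prep u != 0.
Proof.
rewrite /prep vpick0 -dimv_eq0; case: u => u /= /eqP->; exact: oner_neq0.
Qed.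

Lemma prep_span u : (<[prep u]>)%VS = u.
Proof.
apply/eqP; rewrite eqEdim -memvE memv_pick /= dim_vline prep_neq0.
by rewrite (eqP (ppointP u)).
Qed.

Lemma prep_scale (u : ppoint) (U : E) :
  u = (<[U]>)%VS :> {vspace E} -> exists2 k, k != 0 & prep u = k *: U.
Proof.
move=> uU; have: prep u \in (<[U]>)%VS by rewrite -uU memv_pick.
case/vlineP=> k Ek; exists k => //.
by apply: contraNneq (prep_neq0 u) => k0; rewrite Ek k0 scale0r.
Qed.

Definition ptriangle (u v w : ppoint) : Prop :=
  [/\ u != v, v != w, w != u &
      ~ exists P : {vspace E},
          [/\ \dim P = 2%N, (u <= P)%VS, (v <= P)%VS & (w <= P)%VS]].

Variable dot : {symmetric E}.

Definition pnull (u : ppoint) : bool := dot (prep u) (prep u) == 0.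

Definition nonnull_ptriangle (u v w : ppoint) : Prop :=
  ptriangle u v w /\ ~~ [|| pnull u, pnull v | pnull w].

Definition vquadrance (U V : E) : F :=
  1 - dot U V ^+ 2 / (dot U U * dot V V).

Definition quadrance (u v : ppoint) : F := vquadrance (prep u) (prep v).

Definition vreject (W U : E) : E := U - (dot U W / dot W W) *: W.

(* spread w u v is the spread between the lines wu and wv, the common point *)
(* coming first; it is meaningful when spread_defined w u v holds, and it   *)
(* depends only on the two lines and w, see spread_lines.                   *)
Definition spread (w u v : ppoint) : F :=
  vquadrance (vreject (prep w) (prep u)) (vreject (prep w) (prep v)).

Definition vspread_defined (W U V : E) : bool :=
  [&& dot W W != 0, dot (vreject W U) (vreject W U) != 0 &
      dot (vreject W V) (vreject W V) != 0].

Definition spread_defined (w u v : ppoint) : bool :=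
  vspread_defined (prep w) (prep u) (prep v).

Lemma dotZZ a b (U V : E) : dot (a *: U) (b *: V) = a * b * dot U V.
Proof. by rewrite linearZl_LR linearZr_LR /= mulrA. Qed.

Lemma vquadranceZ a b (U V : E) : a != 0 -> b != 0 ->
  vquadrance (a *: U) (b *: V) = vquadrance U V.
Proof.
move=> a0 b0; rewrite /vquadrance !dotZZ; congr (1 - _).
rewrite (_ : a * a * dot U U * _ = (a * b) ^+ 2 * (dot U U * dot V V)); last first.
  by ring.
by rewrite exprMn -mulf_div divff ?mul1r // expf_neq0 // mulf_neq0.
Qed.

Lemma vrejectZ a c (W U : E) : c != 0 ->
  vreject (c *: W) (a *: U) = a *: vreject W U.
Proof.
move=> c0; rewrite /vreject scalerBr !dotZZ !scalerA; congr (_ - _ *: _).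
have [->|W0] := eqVneq (dot W W) 0; first by rewrite !(mulr0, invr0, mul0r).
by field; rewrite W0 c0.
Qed.

Lemma vrejectD a b (W U : E) : dot W W != 0 ->
  vreject W (a *: W + b *: U) = b *: vreject W U.
Proof.
move=> W0; rewrite /vreject linearDl /= !linearZl_LR /= mulrDl mulfK //.
by rewrite scalerDl opprD addrACA subrr add0r scalerBr scalerA mulrA.
Qed.

Lemma pnullE (u : ppoint) (U : E) : u = (<[U]>)%VS :> {vspace E} ->
  pnull u = (dot U U == 0).
Proof.
move=> /prep_scale[a a0 Ea].
by rewrite /pnull Ea dotZZ !mulf_eq0 (negPf a0).
Qed.

Lemma quadranceE (u v : ppoint) (U V : E) :
  u = (<[U]>)%VS :> {vspace E} -> v = (<[V]>)%VS :> {vspace E} ->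
  quadrance u v = 1 - dot U V ^+ 2 / (dot U U * dot V V).
Proof.
move=> /prep_scale[a a0 Ea] /prep_scale[b b0 Eb].
by rewrite /quadrance Ea Eb vquadranceZ.
Qed.

Lemma spread_definedE (w u v : ppoint) (W U V : E) :
    w = (<[W]>)%VS :> {vspace E} -> u = (<[U]>)%VS :> {vspace E} ->
    v = (<[V]>)%VS :> {vspace E} ->
  spread_defined w u v = vspread_defined W U V.
Proof.
move=> /prep_scale[c c0 Ec] /prep_scale[a a0 Ea] /prep_scale[b b0 Eb].
rewrite /spread_defined /vspread_defined Ec Ea Eb !vrejectZ // !dotZZ.
by rewrite !mulf_eq0 (negPf a0) (negPf b0) (negPf c0).
Qed.

Lemma spreadE (w u v : ppoint) (W U V : E) :
    w = (<[W]>)%VS :> {vspace E} -> u = (<[U]>)%VS :> {vspace E} ->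
    v = (<[V]>)%VS :> {vspace E} ->
  let U' := U - (dot U W / dot W W) *: W in
  let V' := V - (dot V W / dot W W) *: W in
  spread w u v = 1 - dot U' V' ^+ 2 / (dot U' U' * dot V' V').
Proof.
move=> /prep_scale[c c0 Ec] /prep_scale[a a0 Ea] /prep_scale[b b0 Eb] /=.
by rewrite /spread Ec Ea Eb !vrejectZ // vquadranceZ.
Qed.

Lemma line_reject (w u u' : ppoint) :
    ~~ pnull w -> u' != w -> (w + u = w + u')%VS ->
  exists2 b, b != 0 &
    vreject (prep w) (prep u') = b *: vreject (prep w) (prep u).
Proof.
move=> w0 u'w ww.
have: prep u' \in (w + u)%VS by rewrite ww (subvP (addvSr w u')) ?memv_pick.
case/memv_addP=> x; rewrite -{1}(prep_span w) => /vlineP[a ->] [y].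
rewrite -{1}(prep_span u) => /vlineP[b ->] Eu'.
exists b; last by rewrite Eu' vrejectD.
apply: contraNneq u'w => b0; rewrite -val_eqE eqEdim /=.
rewrite (eqP (ppointP u')) (eqP (ppointP w)) leqnn andbT -(prep_span u').
by rewrite -memvE Eu' b0 scale0r addr0 memvZ ?memv_pick.
Qed.

Lemma spread_lines (w u v u' v' : ppoint) :
    ~~ pnull w -> u' != w -> v' != w ->
    (w + u = w + u')%VS -> (w + v = w + v')%VS ->
  spread_defined w u v = spread_defined w u' v' /\
  spread w u v = spread w u' v'.
Proof.
move=> w0 u'w v'w wu wv.
have [a a0 Ea] := line_reject w0 u'w wu; have [b b0 Eb] := line_reject w0 v'w wv.
rewrite /spread_defined /vspread_defined /spread Ea Eb vquadranceZ // !dotZZ.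
by rewrite !mulf_eq0 (negPf a0) (negPf b0).
Qed.

End Points.

(* Main.v *)
Require Import Defs.
From mathcomp Require Import all_boot all_order all_algebra.
From mathcomp Require Import ring.
Local Open Scope ring_scope.
Import GRing.Theory.

(** For a vertex with spread [S], put [c = 1 - S], the analogue of the squared
    cosine of an angle. The conclusion says [c_w = c_u * c_v].

    Quadrance one between [u] and [v] says that spanning vectors [U] and [V] are
    orthogonal. Lemma [spread_gram] writes each spread in terms of the inner
    products of [U], [V], [W], with the Gram determinants
    [D_U = (U.U)(W.W) - (U.W)^2] and [D_V = (V.V)(W.W) - (V.W)^2] of the lines
    [uw] and [vw] in the denominators. With [U.V = 0] the Gram determinant of
    [uv] is just [(U.U)(V.V)], and
      [c_w = (U.W)^2 (V.W)^2 / (D_U D_V)],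
      [c_u = (U.U) (V.W)^2 / ((V.V) D_U)],
      [c_v = (V.V) (U.W)^2 / ((U.U) D_V)],
    so that the squared norms cancel in the product [c_u * c_v]. *)

Section Rejection.
Context {F : fieldType} {E : vectType F} (dot : {symmetric E}).
Implicit Types U V W : E.

Lemma dotC U V : dot U V = dot V U.
Proof. by rewrite -[LHS]mul1r hermC /= ?expr0 !mul1r. Qed.

Lemma dot_reject W U V : dot W W != 0 ->
  dot (vreject dot W U) (vreject dot W V) =
    dot U V - dot U W * dot V W / dot W W.
Proof.
move=> W0; rewrite /vreject linearBl linearBr /= linearBr /= !linearZl_LR /=.
rewrite !linearZr_LR /= (dotC W V).
by field.
Qed.

(** Clearing the denominators left by the rejections displays the Gram
    determinants of the two lines, which neighbouring vertices share. *)
Lemma spread_gram W U V : vspread_defined dot W U V ->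
  [/\ dot W W != 0, dot U U * dot W W - dot U W ^+ 2 != 0,
      dot V V * dot W W - dot V W ^+ 2 != 0 &
      vquadrance dot (vreject dot W U) (vreject dot W V) =
        1 - (dot W W * dot U V - dot U W * dot V W) ^+ 2
            / ((dot U U * dot W W - dot U W ^+ 2)
               * (dot V V * dot W W - dot V W ^+ 2))].
Proof.
case/and3P=> W0; rewrite /vquadrance !dot_reject //.
have gram X : dot X X - dot X W * dot X W / dot W W =
    (dot X X * dot W W - dot X W ^+ 2) / dot W W by field.
rewrite !gram !mulf_eq0 !invr_eq0 (negPf W0) !orbF => U0 V0.
by split=> //; field; rewrite W0 U0 V0.
Qed.

Lemma vquadrance1_orthogonal U V : dot U U != 0 -> dot V V != 0 ->
  vquadrance dot U V = 1 -> dot U V = 0.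
Proof.
move=> U0 V0; rewrite -[RHS]subr0 => /addrI/oppr_inj/eqP.
rewrite mulf_eq0 invr_eq0 expf_eq0 mulf_eq0 (negPf U0) (negPf V0) orbF.
by rewrite orbF => /eqP.
Qed.

End Rejection.

Theorem theorem13 (F : fieldType) (char_neq2 : 2%N \notin [pchar F])
    (E : vectType F) (dot : {symmetric E}) (u v w : ppoint E)
    (uvw : nonnull_ptriangle dot u v w)
    (Su_def : spread_defined dot u v w)
    (Sv_def : spread_defined dot v w u)
    (Sw_def : spread_defined dot w u v)
    (qw : quadrance dot u v = 1) :
  spread dot w u v =
    spread dot u v w + spread dot v w u
    - spread dot u v w * spread dot v w u.
Proof.
rewrite /spread.
have [U0 _ UW0 ->] := spread_gram _ _ _ _ Su_def.
have [V0 VW0 _ ->] := spread_gram _ _ _ _ Sv_def.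
have [_ _ _ ->] := spread_gram _ _ _ _ Sw_def.
move: U0 V0 UW0 VW0 (vquadrance1_orthogonal _ _ _ U0 V0 qw).
rewrite (dotC dot (prep v) (prep u)) (dotC dot (prep w) (prep u)).
rewrite (dotC dot (prep w) (prep v)).
move=> U0 V0 UW0 VW0 ->.
by field; apply/and4P; split.
Qed.
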